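(* Let $R$ be a commutative ring with identity and $M$ an $R$-module, and let $R(+)M$ be the trivial extension of $R$ by $M$. Then $$\mathrm{fPD}(R(+)M)=\sup\{\min\{\mathrm{K.grade}_{R}(\mathfrak{m},R),\mathrm{K.grade}_{R}(\mathfrak{m},M)\}\mid \mathfrak{m}\in\mathrm{Max}(R)\}\leq \mathrm{fPD}(R).$$
   Context: $\mathrm{Max}(R)$ is the set of maximal ideals of $R$. Trivial extension: $R(+)M$ is $R\oplus M$ as an $R$-module, with coordinate-wise addition and multiplication $(r_1,m_1)(r_2,m_2)=(r_1r_2,\,r_1m_2+r_2m_1)$; it is a commutative ring with identity $(1,0)$. Small finitistic dimension: for a commutative ring $S$, an $S$-module $N$ has a finite projective resolution if there are an integer $n$ and an exact sequence $0\to P_n\to P_{n-1}\to\cdots\to P_1\to P_0\to N\to 0$ with every $P_i$ a finitely generated projective $S$-module. $\mathrm{fPD}(S)$ is the supremum of the projective dimensions of all $S$-modules having a finite projective resolution (possibly $\infty$). Koszul grade: for a finite sequence $\mathbf{x}=x_1,\dots,x_n$ in $R$, let $K_\bullet(\mathbf{x})$ be the Koszul complex of $\mathbf{x}$ over $R$, and for an $R$-module $N$ let $\mathrm{H}^p(\mathbf{x},N)$ be the $p$-th cohomology of the complex $\mathrm{Hom}_R(K_\bullet(\mathbf{x}),N)$. If $I$ is the ideal generated by $\mathbf{x}$, put $\mathrm{K.grade}_R(I,N)=\inf\{p\in\mathbb{N}\mid \mathrm{H}^p(\mathbf{x},N)\neq 0\}$ (with $\mathbb{N}\ni 0$ and $\inf\emptyset=\infty$);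 this does not depend on the choice of finite generating sequence of $I$. For an arbitrary ideal $J$ of $R$, put $\mathrm{K.grade}_R(J,N)=\sup\{\mathrm{K.grade}_R(I,N)\mid I\subseteq J \text{ a finitely generated ideal of } R\}$. *)

(* Defs.v *)
From HB Require Import structures.
From mathcomp Require Import all_boot all_order all_algebra.
From mathcomp Require Import boolp classical_sets.

Set Implicit Arguments.
Unset Strict Implicit.
Unset Printing Implicit Defensive.

Import Order.TTheory GRing.Theory.

Local Open Scope classical_set_scope.
Local Open Scope ring_scope.

(* [None] stands for infinity. *)
Definition enat := option nat.

HB.instance Definition _ := Choice.on enat.

Definition efin (n : nat) : enat := Some n.
Definition einfty : enat := None.

Definition le_enat (x y : enat) : bool :=
  match x, y with
  | _, None => true
  | None, Some _ => false
  | Some m, Some n => (m <= n)%N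
  end.

Fact le_enat_anti : antisymmetric le_enat.
Proof. by move=> [m|] [n|] //= /anti_leq ->. Qed.

Fact le_enat_trans : transitive le_enat.
Proof. by move=> [n|] [m|] [p|] //=; apply: leq_trans. Qed.

Fact le_enat_total : total le_enat.
Proof. by move=> [m|] [n|] //=; apply: leq_total. Qed.

Fact enat_display : Order.disp_t. Proof. exact: Order.Disp tt tt. Qed.

HB.instance Definition _ := @Order.isOrder.Build enat_display enat
  le_enat _ _ _ (fun _ _ => erefl) (fun _ _ => erefl) (fun _ _ => erefl)
  le_enat_anti le_enat_trans le_enat_total.

(* Suprema and infima of extended naturals, sup set0 = 0, inf set0 = oo;
   the two lemmas below show that the fallback value of [supremum] and
   [infimum] is never used for a nonempty set. *)
Definition esup (A : set enat) : enat := supremum (efin 0) A.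
Definition einf (A : set enat) : enat := infimum einfty A.

Lemma enat_infimums_neq0 (A : set enat) : A !=set0 -> infimums A !=set0.
Proof.
move=> [a Aa]; have [[n An]|noA] := pselect (exists n, A (efin n)).
  have exA : exists n, `[< A (efin n) >] by exists n; apply/asboolP.
  exists (efin (ex_minn exA)); case: ex_minnP => m /asboolP Am mP.
  split; last by move=> y /(_ _ Am).
  by move=> [k|] Ak //; apply: mP; apply/asboolP.
exists einfty; split; last by move=> [].
by move=> [k|] Ak //; case: noA; exists k.
Qed.

Lemma enat_supremums_neq0 (A : set enat) : supremums A !=set0.
Proof.
have [x [xl xu]] : infimums (ubound A) !=set0.
  by apply: enat_infimums_neq0; exists einfty => - [].
by exists x; split=> // a Aa; apply: xu => y /(_ _ Aa).
Qed.

(* A fresh name for the product type, so that it does not carry the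
   coordinate-wise multiplication of [(R * R')%type]. *)
Definition trivext (R : comPzRingType) (M : lmodType R) : Type := (R * M)%type.

Section TrivialExtension.
Variables (R : comPzRingType) (M : lmodType R).
Local Notation E := (trivext M).

HB.instance Definition _ := GRing.Zmodule.copy E (R * M)%type.

Definition trivext_one : E := (1, 0).
Definition trivext_mul (a b : E) : E :=
  (a.1 * b.1, a.1 *: b.2 + b.1 *: a.2).

Fact trivext_mulA : associative trivext_mul.
Proof.
move=> [a u] [b v] [c w]; rewrite /trivext_mul /=; congr (_, _).
  exact: mulrA.
by rewrite !scalerDr !scalerA -addrA (mulrC c a) (mulrC b c).
Qed.

Fact trivext_mulC : commutative trivext_mul.
Proof.
by move=> [a u] [b v]; rewrite /trivext_mul /= mulrC addrC.
Qed.

Fact trivext_mul1 : left_id trivext_one trivext_mul.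
Proof.
by move=> [a u]; rewrite /trivext_mul /= mul1r scale1r scaler0 addr0.
Qed.

Fact trivext_mulDl : left_distributive trivext_mul +%R.
Proof.
move=> [a u] [b v] [c w]; rewrite /trivext_mul /=; congr (_, _).
  exact: mulrDl.
by rewrite scalerDl scalerDr addrACA.
Qed.

HB.instance Definition _ := GRing.Zmodule_isComPzRing.Build E
  trivext_mulA trivext_mulC trivext_mul1 trivext_mulDl.

End TrivialExtension.

Arguments trivext R M : clear implicits.

Section ProjectiveDimension.
Variable S : comPzRingType.

Definition fin_gen (P : lmodType S) : Prop :=
  exists n (e : 'I_n -> P), forall p : P,
    exists c : 'I_n -> S, p = \sum_i c i *: e i.

Definition projective (P : lmodType S) : Prop :=
  forall (A B : lmodType S) (g : {linear A -> B}) (f : {linear P -> B}),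
    (forall b, exists a, g a = b) ->
    exists h : {linear P -> A}, forall p, g (h p) = f p.

(* Exact sequences ... -> P 1 -> P 0 -> N -> 0. *)
Record left_resolution (N : lmodType S) := LeftResolution {
  res_obj : nat -> lmodType S;
  res_diff : forall i, {linear res_obj i.+1 -> res_obj i};
  res_aug : {linear res_obj 0 -> N};
  res_aug_surj : forall y, exists x, res_aug x = y;
  res_exact0 : forall x, res_aug x = 0 <-> exists z, res_diff 0 z = x;
  res_exactS : forall i x,
    res_diff i x = 0 <-> exists z, res_diff i.+1 z = x
}.

(* An exact sequence 0 -> P n -> ... -> P 0 -> N -> 0 is a left resolution
   extended by zero modules in degrees > n. *)
Definition res_length_le (N : lmodType S) (X : left_resolution N) (n : nat) :=
  forall i, (n < i)%N -> forall x : res_obj X i, x = 0.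

Definition finite_proj_resolution (N : lmodType S) : Prop :=
  exists n (X : left_resolution N), res_length_le X n /\
    forall i, projective (res_obj X i) /\ fin_gen (res_obj X i).

Definition proj_dim (N : lmodType S) : enat :=
  einf [set d | exists n (X : left_resolution N),
    [/\ d = efin n, res_length_le X n & forall i, projective (res_obj X i)]].

End ProjectiveDimension.

Definition fPD (S : comPzRingType) : enat :=
  esup [set d | exists N : lmodType S,
    finite_proj_resolution N /\ d = proj_dim N].

Section Ideals.
Variable R : comPzRingType.

Definition is_ideal (I : set R) : Prop :=
  [/\ I 0, forall a b, I a -> I b -> I (a + b) & forall r a, I a -> I (r * a)].

Definition maximal_ideal (m : set R) : Prop :=
  [/\ is_ideal m, m <> setT &
      forall J, is_ideal J -> m `<=` J -> J = m \/ J = setT].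

Definition ideal_gen n (x : 'I_n -> R) : set R :=
  [set a | exists c : 'I_n -> R, a = \sum_i c i * x i].

End Ideals.

Section Koszul.
Variables (R : comPzRingType) (n : nat) (x : 'I_n -> R).

(* The p-element subsets of 'I_n index the standard basis of the p-th
   exterior power of R^n: S = {i_1 < ... < i_p} stands for
   e_S = e_{i_1} /\ ... /\ e_{i_p}. *)
Definition koszul_basis (p : nat) : Type := {S : {set 'I_n} | #|S| == p}.
HB.instance Definition _ p := Finite.on (koszul_basis p).

Definition koszul (p : nat) : lmodType R := {ffun koszul_basis p -> R^o}.

Definition koszul_sign (S : {set 'I_n}) (i : 'I_n) : R :=
  (-1) ^+ #|[set j in S | (j < i)%N]|.

(* e_S |-> \sum_(i in S) koszul_sign S i * x_i * e_(S \ i). *)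
Definition koszul_diff (p : nat) (f : koszul p.+1) : koszul p :=
  [ffun T => \sum_(S : koszul_basis p.+1)
     \sum_(i in val S | val S :\ i == val T) koszul_sign (val S) i * x i * f S].

Fact koszul_diff_is_linear p : linear (@koszul_diff p).
Proof.
move=> a f g; apply/ffunP => T; rewrite !ffunE scaler_sumr -big_split /=.
apply: eq_bigr => S _; rewrite scaler_sumr -big_split /=.
apply: eq_bigr => i _; rewrite !ffunE mulrDr; congr (_ + _).
exact: mulrCA.
Qed.

HB.instance Definition _ p := GRing.isLinear.Build R (koszul p.+1) (koszul p)
  _ (@koszul_diff p) (@koszul_diff_is_linear p).

Fact koszul_diffK p (f : koszul p.+2) : koszul_diff (koszul_diff f) = 0.
Proof.
apply/ffunP => T; rewrite !ffunE.
pose c (U : {set 'I_n}) (i j : 'I_n) : R :=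
  if [&& i \in U, j \in U, i != j & U :\ j :\ i == val T] then
    koszul_sign (U :\ j) i * x i * (koszul_sign U j * x j) else 0.
have cN U (i j : 'I_n) : (i < j)%N -> c U i j = - c U j i.
  move=> lt_ij; rewrite /c andbCA eq_sym !finset.setDDl (finset.setUC [set j]%SET).
  case: ifP => [/and4P[jU iU ne_ji _]|_]; last by rewrite oppr0.
  have -> : koszul_sign (U :\ j) i = koszul_sign U i.
    congr (_ ^+ _); apply: eq_card => k; rewrite !inE.
    by case: eqP => /= [->|_] //; rewrite ltnNge ltnW ?andbF.
  have -> : koszul_sign U j = - koszul_sign (U :\ i) j.
    rewrite /koszul_sign (cardsD1 i) !inE iU lt_ij /= exprS mulN1r.
    by congr (- _ ^+ _); apply: eq_card => k; rewrite !inE andbA.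
  rewrite !mulNr mulrN; congr (- _).
  by rewrite mulrC.
transitivity (\sum_(U : koszul_basis p.+2)
    \sum_i \sum_j c (val U) i j * f U); last first.
  apply: big1 => U _; rewrite pair_big /=.
  rewrite (bigID (fun q : 'I_n * 'I_n => q.1 < q.2)%N) /=.
  rewrite [X in _ + X](bigID (fun q : 'I_n * 'I_n => q.2 < q.1)%N) /=.
  rewrite [X in _ + (_ + X)]big1 ?addr0; last first.
    move=> [i j] /= /andP[]; rewrite -!leqNgt => le_ji le_ij.
    have /val_inj -> : val i = val j by apply/eqP; rewrite eqn_leq le_ij.
    by rewrite /c eqxx /= !andbF mul0r.
  have swapI : involutive (fun q : 'I_n * 'I_n => (q.2, q.1)) by case.
  rewrite [X in _ + X](reindex_inj (inv_inj swapI)) /=.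
  rewrite [X in _ + X](eq_bigl (fun q : 'I_n * 'I_n => q.1 < q.2)%N); last first.
    by move=> [i j] /=; case: ltngtP.
  rewrite -big_split big1 //= => -[i j] /= lt_ij.
  by rewrite cN // mulNr addNr.
pose F (S : koszul_basis p.+1) i (U : koszul_basis p.+2) j : R :=
  if [&& i \in val S, val S :\ i == val T, j \in val U & val U :\ j == val S]
  then koszul_sign (val S) i * x i * (koszul_sign (val U) j * x j) * f U
  else 0.
transitivity (\sum_S \sum_i \sum_U \sum_j F S i U j).
  apply: eq_bigr => S _; rewrite big_mkcond /=; apply: eq_bigr => i _.
  case: ifP => [/andP[iS iT]|iST]; last first.
    by rewrite big1 // => U _; rewrite big1 // => j _; rewrite /F andbA iST.
  rewrite ffunE mulr_sumr; apply: eq_bigr => U _.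
  rewrite mulr_sumr big_mkcond /=; apply: eq_bigr => j _.
  by rewrite /F iS iT /=; case: ifP => _ //; rewrite !mulrA.
rewrite exchange_big /=.
under eq_bigr => i _ do rewrite exchange_big /=.
rewrite exchange_big /=; apply: eq_bigr => U _; apply: eq_bigr => i _.
rewrite exchange_big /=; apply: eq_bigr => j _.
have [jU|jU] := boolP (j \in val U); last first.
  rewrite /c (negPf jU) /= andbF mul0r big1 // => S _.
  by rewrite /F (negPf jU) /= !andbF.
have cardUj : #|val U :\ j| == p.+1.
  by have := valP U; rewrite (cardsD1 j) jU.
rewrite (bigD1 (Sub (val U :\ j) cardUj : koszul_basis p.+1)) //=.
rewrite big1 ?addr0; last first.
  move=> S neS; rewrite /F jU; case: ifP => // /and4P[_ _ _ /eqP eS].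
  by case/eqP: neS; apply: val_inj.
rewrite /F /c /= jU eqxx !inE /= andbT.
by case: (i == j) => /=; rewrite ?andbF ?mul0r //; case: ifP; rewrite ?mul0r.
Qed.

Variable N : lmodType R.

(* Cochains are the elements of Hom_R(K_p, N); the coboundary is composition
   with [koszul_diff]. *)
Definition koszul_cocycle p (phi : {linear koszul p -> N}) : Prop :=
  forall k, phi (koszul_diff k) = 0.

Definition koszul_coboundary p : {linear koszul p -> N} -> Prop :=
  match p with
  | 0 => fun phi => forall k, phi k = 0
  | q.+1 => fun phi => exists psi : {linear koszul q -> N},
      forall k, phi k = psi (koszul_diff k)
  end.

(* H^p(x, N) <> 0. *)
Definition koszul_cohomology_neq0 (p : nat) : Prop :=
  exists phi : {linear koszul p -> N},
    koszul_cocycle phi /\ ~ koszul_coboundary phi.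

Definition koszul_grade_seq : enat :=
  einf [set d | exists p, d = efin p /\ koszul_cohomology_neq0 p].

End Koszul.

(* The finitely generated ideals contained in J are given by their finite
   generating sequences, on the choice of which the grade does not depend. *)
Definition Kgrade (R : comPzRingType) (J : set R) (N : lmodType R) : enat :=
  esup [set d | exists n (x : 'I_n -> R),
    ideal_gen x `<=` J /\ d = koszul_grade_seq x N].

(* Main.v *)
(* For a commutative ring S and p > 0, [p <= fPD S] holds if and only if some
   finite sequence x in S generates a proper ideal and has vanishing Koszul
   cohomology H^j(x,S) for j < p.

   If such an x exists, the complex Hom(K(x),S), truncated in degree p, is a
   finite free resolution of its cokernel; were that cokernel of smaller
   projective dimension, the map S -> S^n given by x would split, and x would
   generate the unit ideal. Conversely, let 0 -> P_p -> ... -> P_0 -> N -> 0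
   be a finite projective resolution of minimal length. As P_p -> P_(p-1)
   does not split, it maps some vector, unimodular modulo a finitely
   generated proper ideal I, into I P_(p-1). As I kills Koszul cohomology,
   dimension shifting along the resolution shows H^j(x,S) = 0 for j < p,
   where x generates I.

   For S = R(+)M the sequence x may be replaced by that of its first
   coordinates, since the two ideals have the same radical, and then
   H^j(x,R(+)M) = H^j(x,R) x H^j(x,M). Finally a proper ideal is contained in
   a maximal one, and vanishing is preserved when x is enlarged. *)

Require Import Defs.
From HB Require Import structures.
From mathcomp Require Import all_boot all_order all_algebra.
From mathcomp Require Import boolp classical_sets.

Set Implicit Arguments.
Unset Strict Implicit.
Unset Printing Implicit Defensive.

Import Order.TTheory GRing.Theory.

Local Open Scope classical_set_scope.
Local Open Scope ring_scope.

(** * Finite lower bounds of suprema and infima *)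

Lemma le_einf p (A : set enat) :
  (efin p <= einf A)%O <-> forall a, A a -> (efin p <= a)%O.
Proof.
rewrite /einf /infimum; case: eqP => [-> | /eqP /set0P A0].
  by split=> // _ a [].
have : infimums A (xget einfty (infimums A)).
  by have [y] := enat_infimums_neq0 A0; apply: xgetI.
set y := xget _ _ => -[yl yu]; split => [py a /yl|]; first exact: le_trans.
by move=> pA; apply: yu => a /pA.
Qed.

(** If no member of [A] reaches [p.+1], then [p] is an upper bound, so a finite bound on the
    supremum is reached by a member. The case [p = 0] stands apart because [esup set0] is 0. *)
Lemma le_esup p (A : set enat) :
  (efin p <= esup A)%O <-> p = 0%N \/ exists2 a, A a & (efin p <= a)%O.
Proof.
have : (A = set0 /\ esup A = efin 0) \/ supremums A (esup A).
  rewrite /esup /supremum; case: eqP => [->|_]; first by left.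
  by right; have [y] := enat_supremums_neq0 A; apply: xgetI.
case=> [[-> ->]|[sA lA]]; split.
- by rewrite /Order.le /=; case: p => // _; left.
- by case=> [->//|[a]].
- case: p => [|p] pE; [by left | right].
  apply: contrapT => nA; suff : (esup A <= efin p)%O.
    by move=> /(le_trans pE); rewrite /Order.le /= ltnn.
  apply: lA => a Aa; case: (leP a (efin p)) => // pa; case: nA; exists a => //.
  by case: a pa {Aa} => [a|] //; rewrite ltNge /Order.le /= -ltnNge.
- by case=> [->|[a /sA]]; [case: (esup A)|move=> ? /le_trans; apply].
Qed.

Section IdealGen.
Variables (R : comPzRingType) (n : nat) (x : 'I_n -> R).

Lemma ideal_gen_is_ideal : is_ideal (ideal_gen x).
Proof.
split=> [|_ _ [c ->] [d ->]|r a [c ->]].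
- by exists (fun _ => 0); rewrite big1 // => i _; rewrite mul0r.
- exists (fun i => c i + d i); rewrite -big_split; apply: eq_bigr => i _.
  by rewrite mulrDl.
- exists (fun i => r * c i); rewrite mulr_sumr; apply: eq_bigr => i _.
  by rewrite mulrA.
Qed.

Lemma ideal_genM a b : ideal_gen x b -> ideal_gen x (a * b).
Proof. by case: ideal_gen_is_ideal => _ _; apply. Qed.

Lemma ideal_gen_sum (I : finType) (P : pred I) (F : I -> R) :
  (forall i, P i -> ideal_gen x (F i)) -> ideal_gen x (\sum_(i | P i) F i).
Proof. by case: ideal_gen_is_ideal => I0 ID _ FP; apply: big_ind. Qed.

Lemma ideal_gen_mem i : ideal_gen x (x i).
Proof.
exists (fun j => (j == i)%:R); rewrite (bigD1 i) //= eqxx mul1r big1 ?addr0 //.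
by move=> j /negPf ->; rewrite mul0r.
Qed.

End IdealGen.

(** * Koszul cochains *)

Section Cochains.
Variables (R : comPzRingType) (n : nat) (x : 'I_n -> R).

(* An ungraded cochain [f] stands for the map e_S |-> f S; the degree is
   imposed by restricting the equations to sets S of a given size. *)
Definition koszul_delta (N : lmodType R) (f : {set 'I_n} -> N)
    (S : {set 'I_n}) : N :=
  \sum_(i in S) (koszul_sign R S i * x i) *: f (S :\ i)%SET.

(** In degree 0 the sum defining [koszul_delta g] is empty, so the only coboundary there is zero, as
    H^0 requires. *)
Definition koszul_vanish (N : lmodType R) (q : nat) : Prop :=
  forall f : {set 'I_n} -> N,
    (forall S : {set 'I_n}, #|S| = q.+1 -> koszul_delta f S = 0) ->
    exists g : {set 'I_n} -> N,
      forall S : {set 'I_n}, #|S| = q -> f S = koszul_delta g S.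

Lemma koszul_sign_sq S (i : 'I_n) : koszul_sign R S i * koszul_sign R S i = 1.
Proof. by rewrite /koszul_sign -expr2 sqrr_sign. Qed.

(** Deleting [i] from the count for [j] and [j] from the count for [i] costs the signs of [i < j]
    and [j < i], exactly one of which is -1. *)
Lemma koszul_sign_swap (S : {set 'I_n}) i j : i \in S -> j \notin S ->
  koszul_sign R (j |: S)%SET j * koszul_sign R (j |: S)%SET i =
  - (koszul_sign R S i * koszul_sign R (j |: (S :\ i))%SET j).
Proof.
move=> iS jS; have ij : i != j by apply: contraNneq jS => <-.
have E (T : {set 'I_n}) a k : k \in T ->
    koszul_sign R T a = (-1) ^+ ((k < a) : nat) * koszul_sign R (T :\ k)%SET a.
  move=> kT; rewrite /koszul_sign -exprD; congr (_ ^+ _).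
  rewrite (cardsD1 k) !inE kT /=; congr (_ + _)%N.
  by apply: eq_card => l; rewrite !inE andbA.
rewrite (E (j |: S)%SET i j) ?finset.setU11 //.
rewrite (E (j |: S)%SET j i) ?inE ?iS ?orbT //.
have -> : ((j |: S) :\ j)%SET = S by rewrite finset.setU1K.
have -> : ((j |: S) :\ i)%SET = (j |: (S :\ i))%SET.
  apply/finset.setP => l; rewrite !inE; case: eqP => [->|//] /=.
  by rewrite (negPf ij).
rewrite mulrACA [in RHS]mulrC -[RHS]mulN1r; congr (_ * _).
by case: ltngtP ij => // [_|_|/val_inj->]; rewrite ?eqxx ?mul1r ?mulr1.
Qed.

Lemma koszul_deltaD (N : lmodType R) (f g : {set 'I_n} -> N) S :
  koszul_delta (fun T => f T + g T) S = koszul_delta f S + koszul_delta g S.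
Proof.
by rewrite -big_split; apply: eq_bigr => i _; rewrite scalerDr.
Qed.

Lemma koszul_delta_sum (N : lmodType R) (I : finType)
    (f : I -> {set 'I_n} -> N) S :
  koszul_delta (fun T => \sum_k f k T) S = \sum_k koszul_delta (f k) S.
Proof.
by rewrite exchange_big; apply: eq_bigr => i _; rewrite scaler_sumr.
Qed.

Lemma koszul_delta_lin (N N' : lmodType R) (h : {linear N -> N'})
    (f : {set 'I_n} -> N) S :
  koszul_delta (fun T => h (f T)) S = h (koszul_delta f S).
Proof. by rewrite linear_sum; apply: eq_bigr => i _; rewrite linearZ. Qed.

Lemma koszul_deltaZ (N : lmodType R) a (f : {set 'I_n} -> N) S :
  koszul_delta (fun T => a *: f T) S = a *: koszul_delta f S.
Proof.
by rewrite scaler_sumr; apply: eq_bigr => i _; rewrite !scalerA mulrC.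
Qed.

Lemma koszul_deltaN (N : lmodType R) (f : {set 'I_n} -> N) S :
  koszul_delta (fun T => - f T) S = - koszul_delta f S.
Proof. by rewrite -sumrN; apply: eq_bigr => i _; rewrite scalerN. Qed.

Lemma koszul_deltaB (N : lmodType R) (f g : {set 'I_n} -> N) S :
  koszul_delta (fun T => f T - g T) S = koszul_delta f S - koszul_delta g S.
Proof. by rewrite koszul_deltaD koszul_deltaN. Qed.

Lemma koszul_delta0 (N : lmodType R) (f : {set 'I_n} -> N) :
  koszul_delta f finset.set0 = 0.
Proof. by apply: big1 => i; rewrite inE. Qed.

Lemma koszul_delta_congr (N : lmodType R) (f g : {set 'I_n} -> N)
    (T : {set 'I_n}) :
  (forall S : {set 'I_n}, #|S|.+1 = #|T| -> f S = g S) ->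
  koszul_delta f T = koszul_delta g T.
Proof.
move=> fg; apply: eq_bigr => i iT; rewrite fg //.
by rewrite [RHS](cardsD1 i) iT.
Qed.

Lemma eq_koszul_delta (N : lmodType R) q (f g : {set 'I_n} -> N) :
  (forall S : {set 'I_n}, #|S| = q -> f S = g S) ->
  forall S : {set 'I_n}, #|S| = q.+1 -> koszul_delta f S = koszul_delta g S.
Proof.
by move=> fg S cS; apply: koszul_delta_congr => T; rewrite cS => -[/fg].
Qed.

(** The term deleting [i] and then [j] cancels the one deleting [j] and then [i]. *)
Lemma koszul_deltaK (N : lmodType R) (f : {set 'I_n} -> N) S :
  koszul_delta (koszul_delta f) S = 0.
Proof.
pose c i j : N := (koszul_sign R S i * x i) *:
  ((koszul_sign R (S :\ i)%SET j * x j) *: f (S :\ i :\ j)%SET).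
pose D (p : 'I_n * 'I_n) := [&& p.1 \in S, p.2 \in S & p.1 != p.2].
have -> : koszul_delta (koszul_delta f) S = \sum_(p | D p) c p.1 p.2.
  rewrite [RHS](eq_bigl (fun p : 'I_n * 'I_n =>
      (p.1 \in S) && (p.2 \in (S :\ p.1)%SET))); last first.
    by case=> i j; rewrite /D !inE /= eq_sym (andbC (j != i)).
  rewrite -(pair_big_dep _ (fun i j => j \in (S :\ i)%SET) c) /=.
  by apply: eq_bigr => i _; rewrite scaler_sumr.
have cN i j : D (i, j) -> c j i = - c i j.
  case/and3P => /= iS jS ij; rewrite /c !scalerA -scaleNr.
  have -> : (S :\ j :\ i = S :\ i :\ j)%SET.
    by rewrite !finset.setDDl finset.setUC.
  congr (_ *: _).
  have := @koszul_sign_swap (S :\ j)%SET i j; rewrite !inE iS ij eqxx.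
  move=> /(_ isT isT); rewrite finset.setD1K //.
  have -> : (j |: (S :\ j :\ i) = S :\ i)%SET.
    apply/finset.setP => l; rewrite !inE; case: eqP => [->|//] /=.
    by rewrite jS eq_sym ij.
  move=> E; have {}E : koszul_sign R S j * koszul_sign R (S :\ j)%SET i =
     - (koszul_sign R S i * koszul_sign R (S :\ i)%SET j).
    rewrite -[LHS]mulr1 -(koszul_sign_sq S i).
    rewrite [LHS]mulrACA E mulNr; congr (- _).
    rewrite -[RHS]mul1r -(koszul_sign_sq (S :\ j)%SET i).
    rewrite [LHS]mulrACA; congr (_ * _); last exact: mulrC.
  by rewrite mulrACA E [in RHS]mulrACA mulNr (mulrC (x j)).
rewrite (bigID (fun p : 'I_n * 'I_n => p.1 < p.2)%N) /=.
have swapK : involutive (fun p : 'I_n * 'I_n => (p.2, p.1)) by case.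
rewrite [X in _ + X](reindex_inj (inv_inj swapK)) /=.
rewrite [X in _ + X](eq_bigl (fun p : 'I_n * 'I_n => D p && (p.1 < p.2)%N)).
  by rewrite -big_split big1 //= => -[i j] /= /andP[/cN-> _]; rewrite addrN.
case=> i j; rewrite /D /= (andbCA (j \in S)) eq_sym -leqNgt.
case: eqP => [->|/eqP ij]; rewrite ?andbF // leq_eqVlt.
by rewrite (_ : (i == j :> nat) = false) //; apply: negPf.
Qed.

(* Contraction against the j-th basis vector is a homotopy between
   multiplication by [x j] and zero. *)
Lemma koszul_annih (N : lmodType R) (f : {set 'I_n} -> N) q j :
  (forall S : {set 'I_n}, #|S| = q.+1 -> koszul_delta f S = 0) ->
  exists g : {set 'I_n} -> N,
    forall S : {set 'I_n}, #|S| = q -> x j *: f S = koszul_delta g S.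
Proof.
move=> df; exists (fun T : {set 'I_n} => if j \in T then 0 else
  koszul_sign R (j |: T)%SET j *: f (j |: T)%SET) => S cS.
have [jS|jS] := boolP (j \in S).
  rewrite /koszul_delta (bigD1 j) //= big1 ?addr0; last first.
    by move=> i /andP[iS ij]; rewrite !inE eq_sym ij jS scaler0.
  by rewrite !inE eqxx /= finset.setD1K // scalerA mulrAC koszul_sign_sq mul1r.
have /df : #|(j |: S)%SET| = q.+1 by rewrite cardsU1 jS cS.
move/(congr1 (fun y => koszul_sign R (j |: S)%SET j *: y)).
rewrite scaler0 /koszul_delta (big_setU1 _ jS) /= scalerDr => /eqP.
rewrite scalerA mulrA koszul_sign_sq mul1r finset.setU1K // addr_eq0 => /eqP ->.
rewrite scaler_sumr -sumrN; apply: eq_bigr => i iS.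
rewrite !inE (negPf jS) andbF.
have -> : ((j |: S) :\ i = j |: (S :\ i))%SET.
  apply/finset.setP => l; rewrite !inE; case: eqP => [->|//] /=.
  by case: eqP => // ij; rewrite -ij iS in jS.
rewrite !scalerA -scaleNr mulrA koszul_sign_swap // mulNr opprK mulrAC.
by [].
Qed.

Lemma koszul_annih_ideal (N : lmodType R) (f : {set 'I_n} -> N) q a :
  ideal_gen x a ->
  (forall S : {set 'I_n}, #|S| = q.+1 -> koszul_delta f S = 0) ->
  exists g : {set 'I_n} -> N,
    forall S : {set 'I_n}, #|S| = q -> a *: f S = koszul_delta g S.
Proof.
move=> [c ->] df; have /choice[g gP] j := koszul_annih j df.
exists (fun T => \sum_j c j *: g j T) => S cS.
rewrite koszul_delta_sum scaler_suml; apply: eq_bigr => j _.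
by rewrite koszul_deltaZ -gP // scalerA.
Qed.

Lemma ideal_gen_delta (f : {set 'I_n} -> R^o) S :
  ideal_gen x (koszul_delta f S).
Proof.
apply: ideal_gen_sum => i _; rewrite [_ *: _]mulrC mulrA.
exact/ideal_genM/ideal_gen_mem.
Qed.

Section ShortExact.
Variables (K P N : lmodType R) (u : {linear K -> P}) (v : {linear P -> N}).
Hypotheses (u_inj : injective u) (v_surj : forall y, exists p, v p = y).
Hypothesis uv_exact : forall p, v p = 0 <-> exists k, u k = p.

(** H^0 is left exact: [u] embeds H^0 of [K] into that of [P]. *)
Lemma koszul_vanish0_sub : koszul_vanish P 0 -> koszul_vanish K 0.
Proof.
move=> VP f df; exists f => S cS.
have [|g /(_ S cS)] := VP (fun T => u (f T)).
  by move=> T cT; rewrite koszul_delta_lin df // linear0.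
move/eqP: cS; rewrite cards_eq0 => /eqP ->.
by rewrite !koszul_delta0 -(linear0 u) => /u_inj ->.
Qed.

(** In the long exact sequence, the kernel of H^(q+1)(K) -> H^(q+1)(P) is the image of H^q(N), which
    vanishes. *)
Lemma koszul_cohomology_inj q (f : {set 'I_n} -> K) : koszul_vanish N q ->
  (exists g : {set 'I_n} -> P,
     forall S : {set 'I_n}, #|S| = q.+1 -> u (f S) = koszul_delta g S) ->
  exists h : {set 'I_n} -> K,
    forall S : {set 'I_n}, #|S| = q.+1 -> f S = koszul_delta h S.
Proof.
move=> VN [g fg].
have vu k : v (u k) = 0 by apply/uv_exact; exists k.
have [|c gc] := VN (fun T => v (g T)).
  by move=> S cS; rewrite koszul_delta_lin -fg.
(* Subtracting the coboundary of a lift [c'] of [c] brings [g] into the image of [K] without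
   changing the coboundary of [g]. *)
have /choice[c' c'P] : forall T, exists p, v p = c T by move=> T.
have /choice[h hP] : forall T : {set 'I_n}, exists k,
    #|T| = q -> u k = g T - koszul_delta c' T.
  move=> T; have [cT|/eqP cT] := eqVneq #|T| q; last by exists 0.
  have /uv_exact[k kP] : v (g T - koszul_delta c' T) = 0.
    rewrite linearB gc //= -koszul_delta_lin /koszul_delta.
    by under [X in _ - X]eq_bigr do rewrite c'P; rewrite subrr.
  by exists k.
exists h => S cS; apply: u_inj; rewrite fg // -koszul_delta_lin.
rewrite -[LHS]subr0 -(koszul_deltaK c' S) -koszul_deltaB.
by apply: (@eq_koszul_delta _ q) => // T /hP.
Qed.

Lemma koszul_vanishS_sub q :
  koszul_vanish N q -> koszul_vanish P q.+1 -> koszul_vanish K q.+1.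
Proof.
move=> VN VP f df; apply: koszul_cohomology_inj => //; apply: VP => S cS.
by rewrite koszul_delta_lin df // linear0.
Qed.

End ShortExact.

End Cochains.

(** * The double complex of two Koszul complexes *)

Section DoubleComplex.
Variables (R : comPzRingType) (k l : nat) (x : 'I_k -> R) (y : 'I_l -> R).
Variable N : lmodType R.
Implicit Type f : {set 'I_k} -> {set 'I_l} -> N.

Lemma koszul_delta_comm f S T :
  koszul_delta x (fun S' => koszul_delta y (f S') T) S =
  koszul_delta y (fun T' => koszul_delta x (f^~ T') S) T.
Proof.
rewrite /koszul_delta; under eq_bigr do rewrite scaler_sumr.
rewrite exchange_big; apply: eq_bigr => j _; rewrite scaler_sumr.
by apply: eq_bigr => i _; rewrite !scalerA mulrC.
Qed.

(** A zigzag by induction on [b]: a primitive [f'], for [y], of the [x]-coboundary of [f] satisfies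
    the same hypothesis with [a] raised and [b] lowered by one, and its decomposition yields a
    correction of [f] that is closed for [x]. *)
Lemma koszul_double_exact b a f :
  (forall j, (j < b)%N -> koszul_vanish y N j) ->
  (forall j, (j <= a + b)%N -> koszul_vanish x N j) ->
  (forall S : {set 'I_k}, #|S| = a.+1 -> exists g, forall T : {set 'I_l},
     #|T| = b -> koszul_delta x (f^~ T) S = koszul_delta y g T) ->
  exists g h, forall (S : {set 'I_k}) (T : {set 'I_l}), #|S| = a -> #|T| = b ->
    f S T = koszul_delta x (g^~ T) S + koszul_delta y (h S) T.
Proof.
elim: b a f => [|b IHb] a f Vy Vx fP.
  have /choice[g gP] : forall T : {set 'I_l}, exists g, #|T| = 0%N ->
      forall S : {set 'I_k}, #|S| = a -> f S T = koszul_delta x g S.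
    move=> T; have [cT|/eqP cT] := eqVneq #|T| 0%N; last by exists (f^~ T).
    have [|S cS|g gP] := Vx a _ (f^~ T); first by rewrite addn0.
      have [g ->//] := fP S cS; move/eqP: cT; rewrite cards_eq0 => /eqP ->.
      exact: koszul_delta0.
    by exists g.
  exists (fun S T => g T S), (fun _ _ => 0) => S T cS cT; rewrite (gP T) //.
  move/eqP: (cT); rewrite cards_eq0 => /eqP ->.
  by rewrite koszul_delta0 addr0.
have /choice[f' f'P] : forall S : {set 'I_k}, exists g, #|S| = a.+1 ->
    forall T : {set 'I_l}, #|T| = b.+1 ->
    koszul_delta x (f^~ T) S = koszul_delta y g T.
  move=> S; have [/fP[g gP]|/eqP cS] := eqVneq #|S| a.+1; last by exists (f S).
  by exists g.
have [|||g [h gh]] := IHb a.+1 f'.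
- by move=> j jb; apply: Vy; apply: ltnW.
- by move=> j; rewrite addSnnS; apply: Vx.
- move=> S cS; apply: (Vy b (leqnn _) (fun T => koszul_delta x (f'^~ T) S)).
  move=> T cT; rewrite -koszul_delta_comm -[RHS](koszul_deltaK x (f^~ T) S).
  by apply: eq_koszul_delta cS => S' cS'; rewrite f'P.
have /choice[w wP] : forall T : {set 'I_l}, exists w, #|T| = b.+1 ->
    forall S : {set 'I_k}, #|S| = a ->
    f S T - koszul_delta y (g S) T = koszul_delta x w S.
  move=> T; have [cT|/eqP cT] := eqVneq #|T| b.+1; last by exists (f^~ T).
  (* By the choice of [g] and [h], the [x]-coboundary of this cochain is twice the [y]-coboundary
     operator applied to [h], hence zero. *)
  have [||w wP] := Vx a _ (fun S => f S T - koszul_delta y (g S) T).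
  - exact: leq_addr.
  - move=> S cS; rewrite koszul_deltaB f'P // koszul_delta_comm.
    rewrite -koszul_deltaB -[RHS](koszul_deltaK y (h S) T).
    by apply: eq_koszul_delta cT => T' cT'; rewrite gh // addrC addKr.
  by exists w.
exists (fun S T => w T S), g => S T cS cT.
by rewrite -(wP T) // subrK.
Qed.

(* The complex [0 -> N -> C^1(x,N) -> ... -> C^q.+1(x,N)] is exact, and its
   first map is multiplication by the [x i]; hence it is injective on the
   Koszul cohomology of [y] in degree [q]. *)
Lemma koszul_coboundary_of_mul q (f : {set 'I_l} -> N) :
  (forall j, (j < q)%N -> koszul_vanish y N j) ->
  (forall j, (j <= q)%N -> koszul_vanish x N j) ->
  (forall i, exists g, forall T : {set 'I_l},
     #|T| = q -> x i *: f T = koszul_delta y g T) ->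
  exists g, forall T : {set 'I_l}, #|T| = q -> f T = koszul_delta y g T.
Proof.
move=> Vy Vx fP.
(* [f] is placed in bidegree (0, q); its [x]-coboundary at the singleton of [i] is [x i *: f] up to
   sign. *)
have [//|//||g [h gh]] := @koszul_double_exact q 0 (fun _ => f).
  move=> S /eqP/cards1P[i ->]; have [g gP] := fP i.
  exists (fun T => koszul_sign R [set i]%SET i *: g T) => T cT.
  by rewrite koszul_deltaZ -gP // /koszul_delta big_set1 scalerA.
exists (h finset.set0) => T cT; rewrite (gh finset.set0 T) ?cards0 //.
by rewrite koszul_delta0 add0r.
Qed.

End DoubleComplex.

(** * Koszul cohomology in terms of ungraded cochains *)

Section CohomologyOfCochains.
Variables (R : comPzRingType) (n : nat) (x : 'I_n -> R) (N : lmodType R).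

Definition koszul_form p (f : {set 'I_n} -> N) (c : koszul R n p) : N :=
  \sum_(S : koszul_basis n p) c S *: f (val S).

Fact koszul_form_is_linear p f : linear (@koszul_form p f).
Proof.
move=> a c d; rewrite /koszul_form scaler_sumr -big_split.
by apply: eq_bigr => S _; rewrite !ffunE scalerDl scalerA.
Qed.

HB.instance Definition _ p f := GRing.isLinear.Build R (koszul R n p) N _
  (@koszul_form p f) (@koszul_form_is_linear p f).

Definition koszul_elt p (S : koszul_basis n p) : koszul R n p :=
  [ffun T => (T == S)%:R].

Lemma koszul_eltE p (c : koszul R n p) : c = \sum_S c S *: koszul_elt S.
Proof.
apply/ffunP => T; rewrite sum_ffunE (bigD1 T) //= !ffunE eqxx [_ *: _]mulr1.
rewrite big1 ?addr0 // => S /negPf neST; rewrite !ffunE eq_sym neST.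
exact: mulr0.
Qed.

Lemma koszul_form_elt p f (S : koszul_basis n p) :
  koszul_form f (koszul_elt S) = f (val S).
Proof.
rewrite /koszul_form (bigD1 S) //= ffunE eqxx scale1r big1 ?addr0 // => T.
by move=> /negPf neTS; rewrite ffunE neTS scale0r.
Qed.

Lemma koszul_form_ex p (phi : {linear koszul R n p -> N}) :
  exists f, forall c, phi c = koszul_form f c.
Proof.
exists (fun T => if insub T is Some U then phi (koszul_elt U) else 0) => c.
rewrite {1}(koszul_eltE c) linear_sum; apply: eq_bigr => S _.
by rewrite linearZ valK.
Qed.

(** [koszul_delta] is the transpose of [koszul_diff]: after exchanging the sums, [S] and [i]
    determine the smaller set [T]. *)
Lemma koszul_form_diff p f (c : koszul R n p.+1) :
  koszul_form f (koszul_diff x c) =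
  \sum_(S : koszul_basis n p.+1) c S *: koszul_delta x f (val S).
Proof.
rewrite /koszul_form; under eq_bigr do rewrite ffunE scaler_suml.
rewrite exchange_big; apply: eq_bigr => S _ /=.
under eq_bigr do rewrite scaler_suml.
rewrite (exchange_big_dep (mem (val S))) /=; last by move=> ? ? _ /andP[].
rewrite /koszul_delta scaler_sumr; apply: eq_bigr => i iS.
have cT : #|(val S :\ i)%SET| == p by have := valP S; rewrite (cardsD1 i) iS.
rewrite (big_pred1 (Sub (val S :\ i)%SET cT : koszul_basis n p)) /=.
  by rewrite scalerA [c S * _]mulrC.
move=> T; by rewrite iS /= eq_sym -val_eqE.
Qed.

Lemma koszul_vanishP p :
  koszul_vanish x N p <-> ~ koszul_cohomology_neq0 x N p.
Proof.
split=> [V [phi [phi0]]|H f df].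
  apply; have [f fP] := koszul_form_ex phi; have [S cS|g gP] := V f.
    have /eqP cS' := cS; rewrite -[RHS](phi0 (koszul_elt (Sub S cS'))).
    rewrite fP koszul_form_diff (bigD1 (Sub S cS')) //= ffunE eqxx scale1r.
    rewrite big1 ?addr0 // => T /negPf neTS; rewrite ffunE neTS.
    exact: scale0r.
  case: p phi f phi0 fP V gP => [|p] phi f phi0 fP V gP /=.
    move=> c; rewrite fP; apply: big1 => S _; rewrite gP ?(eqP (valP S)) //.
    have /eqP := valP S; move/eqP; rewrite cards_eq0 => /eqP ->.
    by rewrite koszul_delta0 scaler0.
  exists (koszul_form g) => c; rewrite fP /= koszul_form_diff.
  by apply: eq_bigr => S _; rewrite gP ?(eqP (valP S)).
apply: contrapT => nf; apply: H; exists (koszul_form f); split.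
  move=> c; rewrite /= koszul_form_diff; apply: big1 => S _.
  by rewrite df ?scaler0 ?(eqP (valP S)).
case: p f df nf => [|p] f df nf /=.
  move=> f0; apply: nf; exists f => S cS; have /eqP cS' := cS.
  have := f0 (koszul_elt (Sub S cS')); rewrite koszul_form_elt /= => ->.
  by move/eqP: cS; rewrite cards_eq0 => /eqP ->; rewrite koszul_delta0.
move=> [psi psiP]; apply: nf; have [g gP] := koszul_form_ex psi.
exists g => S cS; have /eqP cS' := cS.
rewrite -[S]/(val (Sub S cS' : koszul_basis n p.+1)) -koszul_form_elt.
rewrite psiP gP koszul_form_diff (bigD1 (Sub S cS')) //= ffunE eqxx scale1r.
by rewrite big1 ?addr0 // => T /negPf neTS; rewrite ffunE neTS scale0r.
Qed.

Lemma le_koszul_grade_seq p : (efin p <= koszul_grade_seq x N)%O <->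
  forall j, (j < p)%N -> koszul_vanish x N j.
Proof.
rewrite le_einf; split=> [pK j jp|V d [j [-> H]]].
  apply/koszul_vanishP => H; have := pK _ (ex_intro _ j (conj erefl H)).
  by rewrite /Order.le /= leqNgt jp.
by rewrite /Order.le /= leqNgt; apply/negP => /V/koszul_vanishP.
Qed.

End CohomologyOfCochains.

(** * Modules and resolutions *)

(* Induction on the rows: if the entries of the first row generate the unit
   ideal, that row can be split off. *)
Lemma right_invertible_or_proper (R : comPzRingType) r s (A : 'M[R]_(r, s)) :
  (exists B, A *m B = 1%:M) \/
  exists (u : 'rV[R]_r) i, u 0 i = 1 /\ ~ ideal_gen ((u *m A) 0) 1.
Proof.
elim: r A => [|r IHr]; first by left; exists 0; apply/matrixP => - [].
rewrite -[r.+1]/(1 + r)%N => A; rewrite -[A]vsubmxK.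
move: (usubmx A) (dsubmx A) => a A' {A}.
have [[c ac]|noc] := pselect (exists c : 'cV[R]_s, a *m c = 1%:M); last first.
  (* The first unit row picks out [a], whose entries generate a proper ideal. *)
  right; exists (row_mx 1%:M 0), (lshift r 0).
  rewrite row_mxEl mxE mul_row_col mul1mx mul0mx addr0; split=> // -[c c1].
  apply: noc; exists (\col_j c j); apply/matrixP => i j.
  rewrite !ord1 [RHS]mxE c1 mxE; apply: eq_bigr => k _.
  by rewrite [in LHS]mulrC mxE.
(* The reduced matrix kills [c], so it can be inverted independently of the first row. *)
have [[B AB]|[u [i [ui uA]]]] := IHr (A' - A' *m c *m a).
  pose Y := B - c *m (a *m B).
  have aY : a *m Y = 0 by rewrite mulmxBr !mulmxA ac mul1mx subrr.
  have AY : A' *m Y = 1%:M by rewrite -AB mulmxBr mulmxBl !mulmxA.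
  left; exists (row_mx (c - Y *m (A' *m c)) Y).
  rewrite mul_col_row aY AY !mulmxBr !(mulmxA _ Y) aY AY ac mul0mx mul1mx.
  by rewrite subr0 subrr -scalar_mx_block.
(* The first entry is chosen so that the product with the full matrix equals [u] times the reduced
   matrix. *)
right; exists (row_mx (- (u *m A' *m c)) u), (rshift 1 i).
split; first by rewrite row_mxEr.
rewrite mul_row_col mulNmx addrC -!mulmxA -mulmxBr.
by rewrite mulmxA.
Qed.

(** * Kernels, cokernels and projective modules *)

Section KernelCokernel.
Variables (R : comPzRingType) (V W : lmodType R) (f : {linear V -> W}).

Definition ker_pred : {pred V} := fun x => f x == 0.

Fact ker_pred_submod_closed : submod_closed ker_pred.
Proof.
split=> [|a x y]; rewrite !unfold_in ?linear0 // => /eqP fx /eqP fy.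
by rewrite linearP fx fy scaler0 addr0.
Qed.

HB.instance Definition _ :=
  GRing.isSubmodClosed.Build R V ker_pred ker_pred_submod_closed.

Definition kernel : Type := {x : V | x \in ker_pred}.
HB.instance Definition _ := SubType.on kernel.
HB.instance Definition _ := Choice.on kernel.
HB.instance Definition _ := [SubChoice_isSubLmodule of kernel by <:].

Definition ker_incl : {linear kernel -> V} := val.

Lemma ker_incl_inj : injective ker_incl.
Proof. exact: val_inj. Qed.

Lemma ker_inclP x : f x = 0 <-> exists k, ker_incl k = x.
Proof.
split=> [fx|[k <-]]; last by apply/eqP; exact: valP k.
by have kx : x \in ker_pred by [apply/eqP]; exists (Sub x kx).
Qed.

Definition im_pred : {pred W} := fun y => `[< exists x, f x = y >].

Fact im_pred_submod_closed : submod_closed im_pred.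
Proof.
split=> [|a _ _ /asboolP[x <-] /asboolP[y <-]]; apply/asboolP.
  by exists 0; rewrite linear0.
by exists (a *: x + y); rewrite linearP.
Qed.

HB.instance Definition _ :=
  GRing.isSubmodClosed.Build R W im_pred im_pred_submod_closed.

Definition coker : Type := Quotient.quot im_pred.
HB.instance Definition _ := GRing.Zmodule.on coker.

Definition to_coker (y : W) : coker :=
  generic_quotient.pi (Quotient.quot im_pred) y.

Fact to_cokerD : {morph to_coker : x y / x + y}.
Proof. exact: Quotient.pi_add. Qed.

Lemma to_coker_eq x y : to_coker x = to_coker y <-> exists v, f v = x - y.
Proof.
split=> [/eqP|H]; last by apply/eqP; rewrite -Quotient.idealrBE; apply/asboolP.
by rewrite -Quotient.idealrBE => /asboolP.
Qed.

Lemma to_coker_surj c : exists x, to_coker x = c.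
Proof. by exists (generic_quotient.repr c); exact: generic_quotient.reprK. Qed.

(** Independence of the representative is [coker_scaleE]. *)
Definition coker_scale (a : R) (c : coker) : coker :=
  to_coker (a *: generic_quotient.repr c).

Fact coker_scaleE a x : coker_scale a (to_coker x) = to_coker (a *: x).
Proof.
apply/to_coker_eq.
have [v vE] : exists v, f v = generic_quotient.repr (to_coker x) - x.
  by apply/to_coker_eq; exact: generic_quotient.reprK.
by exists (a *: v); rewrite linearZ /= vE scalerBr.
Qed.

Fact coker_scaleA a b c :
  coker_scale a (coker_scale b c) = coker_scale (a * b) c.
Proof. by have [x <-] := to_coker_surj c; rewrite !coker_scaleE scalerA. Qed.

Fact coker_scale1 : left_id 1 coker_scale.
Proof.
by move=> c; have [x <-] := to_coker_surj c; rewrite coker_scaleE scale1r.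
Qed.

Fact coker_scaleDr : right_distributive coker_scale +%R.
Proof.
move=> a c d; have [x <-] := to_coker_surj c; have [y <-] := to_coker_surj d.
by rewrite -to_cokerD !coker_scaleE scalerDr to_cokerD.
Qed.

Fact coker_scaleDl c : {morph coker_scale^~ c : a b / a + b}.
Proof.
move=> a b; have [x <-] := to_coker_surj c.
by rewrite !coker_scaleE scalerDl to_cokerD.
Qed.

HB.instance Definition _ := GRing.Zmodule_isLmodule.Build R coker
  coker_scaleA coker_scale1 coker_scaleDr coker_scaleDl.

Fact to_coker_is_linear : linear to_coker.
Proof. by move=> a x y; rewrite to_cokerD -coker_scaleE. Qed.

HB.instance Definition _ :=
  GRing.isLinear.Build R W coker _ to_coker to_coker_is_linear.

Lemma to_coker0P y : to_coker y = 0 <-> exists v, f v = y.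
Proof. by rewrite -(linear0 to_coker) to_coker_eq subr0. Qed.

End KernelCokernel.

(** As [g] is constant on the fibres of [p], its composite with an arbitrary set-theoretic section
    of [p] is linear. *)
Lemma linear_factor (R : comPzRingType) (A B C : lmodType R)
    (p : {linear A -> B}) (g : {linear A -> C}) :
  (forall b, exists a, p a = b) -> (forall a, p a = 0 -> g a = 0) ->
  exists h : {linear B -> C}, forall a, h (p a) = g a.
Proof.
move=> /choice[s sP] pg.
have gs a : g (s (p a)) = g a.
  by apply/eqP; rewrite -subr_eq0 -linearB pg // linearB sP subrr.
have lin : linear (fun b => g (s b)).
  by move=> c b b'; rewrite -{1}(sP b) -{1}(sP b') -linearP gs linearP.
exists (HB.pack_for {linear B -> C} (fun b => g (s b))
  (GRing.isLinear.Build R B C _ (fun b => g (s b)) lin)).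
exact: gs.
Qed.

(* Projectivity against [d] corestricted to its image, obtained by pulling
   [d] back along [f]. *)
Lemma projective_lift (R : comPzRingType) (P A B : lmodType R)
    (d : {linear A -> B}) (f : {linear P -> B}) :
  projective P -> (forall p, exists a, d a = f p) ->
  exists h : {linear P -> A}, forall p, d (h p) = f p.
Proof.
move=> projP fd.
pose e (t : (A * P)%type) := d t.1 - f t.2.
have lin : linear e.
  move=> c [a p] [a' p']; rewrite /e /= (linearP d) (linearP f) scalerBr opprD.
  by rewrite addrACA.
pose E := HB.pack_for {linear (A * P)%type -> B} e
  (GRing.isLinear.Build R _ _ _ e lin).
have [|h hP] := projP (kernel E) P (snd \o ker_incl E) idfun.
  move=> p; have [a ap] := fd p.
  have /ker_inclP[k kP] : E (a, p) = 0 by rewrite /= /e /= ap subrr.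
  by exists k; exact: (congr1 snd kP).
exists (fst \o ker_incl E \o h) => p.
have hp2 : (ker_incl E (h p)).2 = p := hP p.
have /eqP : E (ker_incl E (h p)) = 0 by apply/ker_inclP; exists (h p).
by rewrite subr_eq0 hp2 => /eqP.
Qed.

Lemma projective_retract (R : comPzRingType) (P Q : lmodType R)
    (i : {linear Q -> P}) (r : {linear P -> Q}) :
  cancel i r -> projective P -> projective Q.
Proof.
move=> irK projP A B g f gsurj.
have [h hP] := projP A B g (f \o r) gsurj.
by exists (h \o i) => q /=; rewrite hP /= irK.
Qed.

Lemma fin_gen_image (R : comPzRingType) (P Q : lmodType R)
    (r : {linear P -> Q}) :
  (forall q, exists p, r p = q) -> fin_gen P -> fin_gen Q.
Proof.
move=> rsurj [n [e eP]]; exists n, (r \o e) => q; have [p <-] := rsurj q.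
have [c ->] := eP p; exists c; rewrite linear_sum; apply: eq_bigr => i _.
by rewrite linearZ.
Qed.

Section Free.
Variables (R : comPzRingType) (I : finType).
Local Notation F := {ffun I -> R^o}.

Definition free_elt (i : I) : F := [ffun j => (j == i)%:R].

Lemma free_eltE (c : F) : c = \sum_i (c i : R) *: free_elt i.
Proof.
apply/ffunP => j; rewrite sum_ffunE (bigD1 j) //= !ffunE eqxx [_ *: _]mulr1.
rewrite big1 ?addr0 // => i /negPf neij; rewrite !ffunE eq_sym neij.
exact: mulr0.
Qed.

Definition free_map (V : lmodType R) (v : I -> V) (c : F) : V :=
  \sum_i (c i : R) *: v i.

Fact free_map_is_linear (V : lmodType R) (v : I -> V) : linear (@free_map V v).
Proof.
move=> a c d; rewrite /free_map scaler_sumr -big_split.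
by apply: eq_bigr => i _; rewrite !ffunE scalerDl scalerA.
Qed.

HB.instance Definition _ (V : lmodType R) (v : I -> V) :=
  GRing.isLinear.Build R F V _ (@free_map V v) (@free_map_is_linear V v).

Lemma free_projective : projective F.
Proof.
move=> A B g f gsurj; have /choice[a aP] i := gsurj (f (free_elt i)).
exists (free_map a) => c; rewrite [in RHS](free_eltE c) !linear_sum.
by apply: eq_bigr => i _; rewrite !linearZ aP.
Qed.

Lemma free_fin_gen : fin_gen F.
Proof.
exists #|I|, (fun k => free_elt (enum_val k)) => c.
exists (fun k => c (enum_val k)); rewrite {1}(free_eltE c).
rewrite (reindex_onto enum_val enum_rank) => [|i _]; last exact: enum_rankK.
by apply: eq_bigl => i; rewrite enum_valK eqxx.
Qed.

End Free.

(** The [c i] are the coordinates of a splitting of a surjection from a finite free module onto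
    [P]. *)
Lemma dual_basis (R : comPzRingType) (P : lmodType R) :
  projective P -> fin_gen P ->
  exists n (b : 'I_n -> P) (c : 'I_n -> {linear P -> R^o}),
    forall p, p = \sum_i (c i p : R) *: b i.
Proof.
move=> projP [n [b bP]].
have [|h hP] := projP _ _ (free_map b) idfun.
  move=> p; have [c cP] := bP p; exists [ffun i => c i]; rewrite [RHS]cP.
  by apply: eq_bigr => i _; rewrite ffunE.
have lin i : linear (fun p => h p i).
  by move=> a p q; rewrite linearP !ffunE.
exists n, b, (fun i => HB.pack_for {linear P -> R^o} (fun p => h p i)
  (GRing.isLinear.Build R P R^o _ (fun p => h p i) (lin i))) => p.
by rewrite -[LHS](hP p).
Qed.

(** * Finite projective resolutions and the upper bound on their length *)

Section FiniteResolutions.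
Variable R : comPzRingType.

(** A resolution of length [n] cut into short exact sequences, [K] being the next syzygy, so that
    dimension shifting becomes induction on [n]. *)
Fixpoint fin_proj_chain (n : nat) (N : lmodType R) : Prop :=
  if n is n'.+1 then
    exists (K P : lmodType R) (u : {linear K -> P}) (v : {linear P -> N}),
    [/\ injective u, forall y, exists p, v p = y,
        forall p, v p = 0 <-> exists k, u k = p,
        projective P /\ fin_gen P & fin_proj_chain n' K]
  else projective N /\ fin_gen N.

Definition res_shift (N : lmodType R) (X : left_resolution N)
    (g : {linear res_obj X 1 -> kernel (res_aug X)})
    (gE : forall x, ker_incl (res_aug X) (g x) = res_diff X 0 x) :
  left_resolution (kernel (res_aug X)).
Proof.
apply: (@LeftResolution R _ (fun i => res_obj X i.+1)
          (fun i => res_diff X i.+1) g) => [y|x|i x].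
- have /res_exact0[z zP] : res_aug X (ker_incl (res_aug X) y) = 0.
    by apply/ker_inclP; exists y.
  by exists z; apply: (@ker_incl_inj _ _ _ (res_aug X)); rewrite gE.
- rewrite -res_exactS -gE -(linear0 (ker_incl (res_aug X))).
  by split=> [->//|/ker_incl_inj].
- exact: res_exactS.
Defined.

Lemma fin_proj_chain_of_resolution n (N : lmodType R) (X : left_resolution N) :
  res_length_le X n ->
  (forall i, projective (res_obj X i) /\ fin_gen (res_obj X i)) ->
  fin_proj_chain n N.
Proof.
elim: n N X => [|n IHn] N X Xn XP.
  have [P0 F0] := XP 0%N.
  (* In length 0 the augmentation is injective, and [h] is its inverse. *)
  have [||h hP] := @linear_factor _ _ _ _ (res_aug X) idfun.
  - exact: res_aug_surj.
  - by move=> x /res_exact0[z <-]; rewrite [z](Xn 1%N isT) linear0.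
  split; last by apply: fin_gen_image F0; exact: res_aug_surj.
  apply: (@projective_retract _ _ _ h (res_aug X)) P0 => y.
  by have [x <-] := res_aug_surj X y; rewrite hP.
have [|g gE] := @projective_lift _ _ _ _ (ker_incl (res_aug X)) (res_diff X 0)
    (proj1 (XP 1%N)).
  by move=> x; apply/ker_inclP/res_exact0; exists x.
exists (kernel (res_aug X)), (res_obj X 0), (ker_incl _), (res_aug X); split.
- exact: ker_incl_inj.
- exact: res_aug_surj.
- exact: ker_inclP.
- exact: XP.
- apply: (IHn _ (res_shift gE)) => [i ni x|i]; last exact: (XP i.+1).
  exact: (Xn i.+1).
Qed.

Definition res_cons (K P N : lmodType R) (u : {linear K -> P})
    (v : {linear P -> N}) (u_inj : injective u)
    (v_surj : forall y, exists p, v p = y)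
    (uv : forall p, v p = 0 <-> exists k, u k = p) (X : left_resolution K) :
  left_resolution N.
Proof.
pose obj i := if i is j.+1 then res_obj X j else P.
pose diff i : {linear obj i.+1 -> obj i} :=
  match i with 0 => u \o res_aug X | j.+1 => res_diff X j end.
refine (@LeftResolution R N obj diff v v_surj _ _) => [p|[|i] x].
- rewrite uv; split=> [[k <-]|[z <-]]; last by exists (res_aug X z).
  by have [z <-] := res_aug_surj X k; exists z.
- rewrite -res_exact0 /=; split=> [|->]; last exact: linear0.
  by rewrite -{1}(linear0 u) => /u_inj.
- exact: res_exactS.
Defined.

Definition zero_module : lmodType R := {ffun 'I_0 -> R^o}.

Lemma zero_moduleE (x : zero_module) : x = 0.
Proof. by apply/ffunP => - []. Qed.

Definition zero_resolution : left_resolution zero_module.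
Proof.
apply: (@LeftResolution R _ (fun _ => zero_module) (fun _ => \0) \0).
- by move=> y; exists 0; rewrite [y]zero_moduleE.
- by move=> x; split=> // _; exists 0; rewrite [x]zero_moduleE.
- by move=> i x; split=> // _; exists 0; rewrite [x]zero_moduleE.
Defined.

Lemma resolution_of_fin_proj_chain n (N : lmodType R) :
  fin_proj_chain n N ->
  exists X : left_resolution N,
    res_length_le X n /\ forall i, projective (res_obj X i).
Proof.
elim: n N => [|n IHn] N.
  move=> [projN _].
  have u_inj : injective (\0 : {linear zero_module -> N}).
    by move=> x y _; rewrite [x]zero_moduleE [y]zero_moduleE.
  have v_surj y : exists p, (idfun : {linear N -> N}) p = y by exists y.
  have uv p : (idfun : {linear N -> N}) p = 0 <->
      exists k, (\0 : {linear zero_module -> N}) k = p.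
    by split=> [/= ->|[k <-]//]; exists 0.
  exists (res_cons u_inj v_surj uv zero_resolution).
  split=> [[]// i _ x|[|i]] //=; first exact: zero_moduleE.
  exact: free_projective.
move=> [K [P [u [v [u_inj v_surj uv [projP _] /IHn[X [Xn Xproj]]]]]]].
exists (res_cons u_inj v_surj uv X); by split=> [[]// i ni x|[|i]] //=.
Qed.

Lemma le_proj_dim p (N : lmodType R) :
  (efin p <= proj_dim N)%O <-> forall n (X : left_resolution N),
    res_length_le X n -> (forall i, projective (res_obj X i)) -> (p <= n)%N.
Proof.
rewrite le_einf; split=> [pN n X Xn Xproj|pN d [n [X [-> Xn Xproj]]]].
  by apply: (pN (efin n)); exists n, X.
exact: (pN n X).
Qed.

(** A dual basis reduces this to coordinate cochains, which have values in the ring. *)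
Lemma koszul_vanish_proj r (y : 'I_r -> R) q (Q : lmodType R) :
  koszul_vanish y R^o q -> projective Q -> fin_gen Q -> koszul_vanish y Q q.
Proof.
move=> V projQ fgQ f df; have [n [b [c bc]]] := dual_basis projQ fgQ.
have /choice[g gP] : forall i, exists g : {set 'I_r} -> R^o,
    forall T : {set 'I_r}, #|T| = q -> c i (f T) = koszul_delta y g T.
  by move=> i; apply: V => T cT; rewrite koszul_delta_lin df // linear0.
exists (fun T => \sum_i (g i T : R) *: b i) => T cT.
rewrite koszul_delta_sum [LHS]bc; apply: eq_bigr => i _.
rewrite gP // /koszul_delta scaler_suml; apply: eq_bigr => j _.
by rewrite scalerA.
Qed.

Section TopDegree.
Variables (K P N : lmodType R) (u : {linear K -> P}) (v : {linear P -> N}).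
Hypotheses (u_inj : injective u) (v_surj : forall y, exists p, v p = y).
Hypothesis uv_exact : forall p, v p = 0 <-> exists k, u k = p.

(** The map [p - u (l p)] kills the image of [u], so it factors through [N] and gives a section of
    [v]. *)
Lemma cokernel_projective (l : {linear P -> K}) :
  (forall k, l (u k) = k) -> projective P -> projective N.
Proof.
move=> lu projP.
have lin : linear (fun p => p - u (l p)).
  by move=> a p p'; rewrite (linearP l) (linearP u) scalerBr opprD addrACA.
pose g := HB.pack_for {linear P -> P} (fun p => p - u (l p))
  (GRing.isLinear.Build R P P _ (fun p => p - u (l p)) lin).
have vu k : v (u k) = 0 by apply/uv_exact; exists k.
have [//||s sP] := @linear_factor _ _ _ _ v g.
  by move=> p /uv_exact[k <-]; rewrite /= lu subrr.
apply: (@projective_retract _ _ _ s v) projP => y.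
by have [p <-] := v_surj y; rewrite sP /= linearB vu subr0.
Qed.

(* With [c] the idempotent of a dual basis of [K], the matrix [A] is that of
   [u], extended by [1 - c] to account for the complement of [K] in a free
   module. If [A] has no right inverse, then the entries of [w *m A] generate
   a proper ideal [I] for some row [w], and for the corresponding [k] in [K]
   the element [u k] is in [I P] while a linear form takes a value congruent
   to 1 modulo [I] at [k]. As [I] kills Koszul cohomology, the injection of
   the cohomology of [K] into that of [P] must vanish on the classes
   supported by [k]. *)
Lemma cokernel_projective_or_proper :
  projective K -> fin_gen K -> projective P -> fin_gen P ->
  projective N \/
  exists r (y : 'I_r -> R), ~ ideal_gen y 1 /\
    forall q, (forall j, (j < q)%N -> koszul_vanish y N j) ->
              koszul_vanish y R^o q.
Proof.
move=> projK fgK projP fgP.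
have [n [b [c bc]]] := dual_basis projK fgK.
have [m [b' [c' bc']]] := dual_basis projP fgP.
pose E := \matrix_(i, k) (c k (b i) : R).
pose A1 := \matrix_(i, j) (c' j (u (b i)) : R).
have c'u j k : c' j (u k) = \sum_i (c i k : R) * A1 i j.
  rewrite {1}(bc k) !linear_sum; apply: eq_bigr => i _.
  by rewrite !linearZ mxE.
have EA : E *m A1 = A1.
  apply/matrixP => i j; rewrite !mxE c'u; apply: eq_bigr => k _.
  by rewrite mxE.
have EE : E *m E = E.
  apply/matrixP => i j; rewrite !mxE [in RHS](bc (b i)) linear_sum.
  by apply: eq_bigr => k _; rewrite !mxE linearZ.
have [[B]|[w [i [wi wA]]]] := right_invertible_or_proper (row_mx A1 (1%:M - E)).
  (* The idempotent [E] kills the block [1 - E] and fixes [A1], leaving [A1 *m usubmx B = E]; hence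
     the map [s] with matrix [usubmx B] is a left inverse of [u]. *)
  rewrite -[B]vsubmxK mul_row_col => /(congr1 (mulmx E)).
  rewrite mulmxDr !mulmxA mulmxBr EA EE mulmx1 subrr mul0mx addr0 => AB.
  left; pose b'' j := \sum_k usubmx B j k *: b k.
  have lin : linear (fun p => \sum_j (c' j p : R) *: b'' j).
    move=> a p p'; rewrite scaler_sumr -big_split; apply: eq_bigr => j _.
    by rewrite linearP scalerDl scalerA.
  pose s := HB.pack_for {linear P -> K} (fun p => \sum_j (c' j p : R) *: b'' j)
    (GRing.isLinear.Build R P K _ _ lin).
  apply: (cokernel_projective (l := s)) projP => k; rewrite [s _]/=.
  transitivity (\sum_i (c i k : R) *: \sum_l E i l *: b l).
    rewrite -AB /b''; under eq_bigr => j _.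
      rewrite c'u scaler_suml; under eq_bigr do rewrite -scalerA.
      over.
    rewrite exchange_big; apply: eq_bigr => i _; rewrite -scaler_sumr.
    congr (_ *: _); under eq_bigr do rewrite scaler_sumr.
    rewrite exchange_big; apply: eq_bigr => l _.
    by rewrite mxE scaler_suml; apply: eq_bigr => j _; rewrite scalerA.
  rewrite [RHS]bc; apply: eq_bigr => i _; congr (_ *: _).
  by rewrite [RHS]bc; apply: eq_bigr => l _; rewrite mxE.
right; exists (m + n)%N, ((w *m row_mx A1 (1%:M - E)) 0); split=> //.
move: wA; rewrite mul_mx_row; set y := _ 0 => wA q VN f df.
pose k := \sum_l w 0 l *: b l.
have uk j : c' j (u k) = y (lshift n j).
  rewrite /y row_mxEl mxE !linear_sum; apply: eq_bigr => l _.
  by rewrite !linearZ mxE.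
have ck : c i k = 1 - y (rshift m i).
  rewrite /y row_mxEr mulmxBr mulmx1 !mxE wi opprB addrC subrK linear_sum.
  by apply: eq_bigr => l _; rewrite linearZ mxE.
have /choice[g gP] : forall a, exists g : {set 'I_(m + n)} -> R^o,
    forall T : {set 'I_(m + n)}, #|T| = q -> y a *: f T = koszul_delta y g T.
  by move=> a; apply: koszul_annih_ideal => //; exact: ideal_gen_mem.
have [h hP] : exists h : {set 'I_(m + n)} -> K,
    forall T : {set 'I_(m + n)}, #|T| = q ->
      (f T : R) *: k = koszul_delta y h T.
  have ufk : exists g' : {set 'I_(m + n)} -> P, forall T : {set 'I_(m + n)},
      #|T| = q -> u ((f T : R) *: k) = koszul_delta y g' T.
    exists (fun T => \sum_j (g (lshift n j) T : R) *: b' j) => T cT.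
    rewrite koszul_delta_sum [LHS]bc'; apply: eq_bigr => j _.
    have -> : c' j (u ((f T : R) *: k)) = koszul_delta y (g (lshift n j)) T.
      by rewrite -gP // !linearZ uk; exact: mulrC.
    rewrite /koszul_delta scaler_suml.
    by apply: eq_bigr => a _; rewrite scalerA.
  case: q {df gP} VN ufk => [|q] VN ufk; last first.
    by apply: (koszul_cohomology_inj u_inj v_surj uv_exact _ ufk); apply: VN.
  have [g' g'P] := ufk; exists (fun _ => 0) => T cT; apply: u_inj.
  rewrite g'P //; move/eqP: cT; rewrite cards_eq0 => /eqP ->.
  by rewrite !koszul_delta0 linear0.
(* Since [c i k = 1 - y (rshift m i)], [f] is the sum of its multiples by [c i k] and by
   [y (rshift m i)], both of which are coboundaries. *)
exists (fun T => c i (h T) + g (rshift m i) T) => T cT.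
rewrite koszul_deltaD koszul_delta_lin -hP // -gP // linearZ ck.
rewrite -[LHS]mulr1 -{1}(subrK (y (rshift m i)) 1) mulrDr.
by congr (_ + _); exact: mulrC.
Qed.

End TopDegree.

(** The last short exact sequence of the chain is the case already treated. Going back from [K] to
    [N] shifts degrees by one, as H^j(K) vanishes along with H^j(P) and H^(j-1)(N). *)
Lemma fin_proj_chain_dichotomy n (N : lmodType R) : fin_proj_chain n.+1 N ->
  fin_proj_chain n N \/
  exists r (y : 'I_r -> R), ~ ideal_gen y 1 /\
    forall q, (forall j, (j < q)%N -> koszul_vanish y R^o j) ->
              (forall j, (j + n < q)%N -> koszul_vanish y N j) ->
              koszul_vanish y R^o q.
Proof.
elim: n N => [|n IHn] N [K [P [u [v [u_inj v_surj uv [projP fgP] chainK]]]]].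
  have [projK fgK] := chainK.
  have [projN|[r [y [y1 yV]]]] :=
    cokernel_projective_or_proper u_inj v_surj uv projK fgK projP fgP.
    by left; split=> //; apply: fin_gen_image fgP; exact: v_surj.
  right; exists r, y; split=> // q _ VN; apply: yV => j jq.
  by apply: VN; rewrite addn0.
have [chainK'|[r [y [y1 yV]]]] := IHn K chainK.
  by left; exists K, P, u, v.
right; exists r, y; split=> // q VR VN; apply: yV => // j jq.
have VP : koszul_vanish y P j.
  apply: koszul_vanish_proj => //; apply: VR; apply: leq_ltn_trans jq.
  exact: leq_addr.
case: j jq VP => [|j] jq VP; first exact: (koszul_vanish0_sub u_inj VP).
by apply: (koszul_vanishS_sub u_inj v_surj uv _ VP); apply: VN; rewrite addnS.
Qed.

Lemma proper_of_le_fPD p : (efin p.+1 <= fPD R)%O ->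
  exists r (y : 'I_r -> R), ~ ideal_gen y 1 /\
    forall j, (j < p.+1)%N -> koszul_vanish y R^o j.
Proof.
move=> /le_esup[//|[_ [N [[n [X [Xn XP]]] ->]] pN]].
(* Minimality of the length rules out the first alternative of the dichotomy. *)
have exk : exists k, `[< fin_proj_chain k N >].
  by exists n; apply/asboolP/(fin_proj_chain_of_resolution Xn).
case: (ex_minnP exk) => k /asboolP chain_k k_min.
have pk : (p.+1 <= k)%N.
  have [Y [Yk Yproj]] := resolution_of_fin_proj_chain chain_k.
  exact: (proj1 (le_proj_dim _ _) pN k Y Yk Yproj).
case: k pk chain_k k_min => // k pk /fin_proj_chain_dichotomy[chain_k|].
  by move/(_ k); rewrite ltnn => /(_ (asboolT chain_k)).
move=> [r [y [y1 yV]]] _; exists r, y; split=> // j jp.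
have {jp} : (j < k.+1)%N by exact: leq_trans jp pk.
elim/ltn_ind: j => j IHj jk; apply: yV => [i ij|i].
  by apply: IHj => //; exact: ltn_trans jk.
(* The condition on [N] is vacuous: [i + k < j] contradicts [j <= k]. *)
by move=> ikj; have := leq_trans ikj (jk : (j <= k)%N); rewrite ltnNge leq_addl.
Qed.

End FiniteResolutions.

(** * Lower bounds on the projective dimension *)

(* Lifting the identity of [N] to chain maps [f : X -> Y] and [b : Y -> X],
   the composite [b f] is homotopic to the identity, through a homotopy [h];
   the third invariant is all that is needed of the relation between
   [h i] and [h i.-1]. *)
Lemma resolution_top_split (R : comPzRingType) (N : lmodType R)
    (X Y : left_resolution N) n :
  (forall i, projective (res_obj X i)) ->
  (forall i, projective (res_obj Y i)) ->
  res_length_le X n.+1 -> res_length_le Y n ->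
  exists h : {linear res_obj X n -> res_obj X n.+1},
    forall z, h (res_diff X n z) = z.
Proof.
move=> Xproj Yproj Xn Yn.
have dd (Z : left_resolution N) i x : res_diff Z i (res_diff Z i.+1 x) = 0.
  by apply/res_exactS; exists x.
have ad (Z : left_resolution N) x : res_aug Z (res_diff Z 0 x) = 0.
  by apply/res_exact0; exists x.
have lift0 (Z W : left_resolution N) : projective (res_obj Z 0) ->
    exists f : {linear res_obj Z 0 -> res_obj W 0},
      forall z, res_aug W (f z) = res_aug Z z.
  by move=> Zproj; apply: projective_lift => // z; exact: res_aug_surj.
have ddP (Z : left_resolution N) i x : res_diff Z i x = 0 ->
    exists z, res_diff Z i.+1 z = x by move/res_exactS.
have step i : exists
    (f : {linear res_obj X i -> res_obj Y i})
    (b : {linear res_obj Y i -> res_obj X i})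
    (h : {linear res_obj X i -> res_obj X i.+1}),
    [/\ forall z, exists w, res_diff Y i w = f (res_diff X i z),
        forall w, exists z, res_diff X i z = b (res_diff Y i w) &
        forall z, res_diff X i (h (res_diff X i z)) =
                  res_diff X i z - b (f (res_diff X i z))].
  elim: i => [|i [f [b [h [fP bP hP]]]]].
    have [f fP] := lift0 X Y (Xproj 0%N).
    have [b bP] := lift0 Y X (Yproj 0%N).
    have [|h hP] := @projective_lift _ _ _ _ (res_diff X 0)
        (idfun \- (b \o f)) (Xproj 0%N).
      by move=> x; apply/res_exact0; rewrite /= linearB bP fP subrr.
    exists f, b, h; split=> z; last by rewrite hP.
      by apply/res_exact0; rewrite fP ad.
    by apply/res_exact0; rewrite bP ad.
  have [//|f' f'P] := @projective_lift _ _ _ _ (res_diff Y i)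
      (f \o res_diff X i) (Xproj i.+1).
  have [//|b' b'P] := @projective_lift _ _ _ _ (res_diff X i)
      (b \o res_diff Y i) (Yproj i.+1).
  rewrite /= in f'P b'P.
  have [|h' h'P] := @projective_lift _ _ _ _ (res_diff X i.+1)
      ((idfun \- (b' \o f')) \- (h \o res_diff X i)) (Xproj i.+1).
    move=> x; apply/res_exactS.
    by rewrite /= !linearB b'P f'P hP opprB addrA subrK subrr.
  exists f', b', h'; split=> z; last by rewrite h'P /= dd linear0 subr0.
    by apply/res_exactS; rewrite f'P dd linear0.
  by apply/res_exactS; rewrite b'P dd linear0.
have [f [b [h [fP _ hP]]]] := step n.
exists h => z; apply/eqP; rewrite -subr_eq0; apply/eqP.
(* The values of [f] on boundaries come from [res_obj Y n.+1], which is zero; so this difference is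
   a cycle, hence a boundary from the zero module [res_obj X n.+2]. *)
have [w wE] : exists w, res_diff X n.+1 w = h (res_diff X n z) - z.
  apply/res_exactS; rewrite linearB hP; have [w <-] := fP z.
  by rewrite [w]Yn // !linear0 addr0 subrr.
by rewrite -wE [w]Xn // linear0.
Qed.

Section KoszulResolution.
Variables (R : comPzRingType) (r : nat) (y : 'I_r -> R) (p : nat).

(* The cochain modules of [y], numbered backwards from degree [p] and
   vanishing beyond degree 0. *)
Definition koszul_cobasis (i : nat) : Type :=
  {S : {set 'I_r} | (#|S| + i == p)%N}.
HB.instance Definition _ i := Finite.on (koszul_cobasis i).

Definition koszul_comod (i : nat) : lmodType R :=
  {ffun koszul_cobasis i -> R^o}.

Definition koszul_ext i (f : koszul_comod i) (S : {set 'I_r}) : R^o :=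
  if insub S is Some U then f U else 0.

Lemma koszul_ext_val i (f : koszul_comod i) (U : koszul_cobasis i) :
  koszul_ext f (val U) = f U.
Proof. by rewrite /koszul_ext valK. Qed.

Lemma koszul_extE i (g : {set 'I_r} -> R^o) (S : {set 'I_r}) :
  (#|S| + i)%N = p ->
  koszul_ext [ffun U : koszul_cobasis i => g (val U)] S = g S.
Proof.
move/eqP => cS; rewrite -[S in LHS]/(val (Sub S cS : koszul_cobasis i)).
by rewrite koszul_ext_val ffunE.
Qed.

Definition koszul_codiff i (f : koszul_comod i.+1) : koszul_comod i :=
  [ffun U => koszul_delta y (koszul_ext f) (val U)].

Fact koszul_codiff_is_linear i : linear (@koszul_codiff i).
Proof.
move=> a f g; apply/ffunP => U; rewrite !ffunE -koszul_deltaZ -koszul_deltaD.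
apply: koszul_delta_congr => T _; rewrite /koszul_ext.
by case: insubP => [V _ _|_]; rewrite ?ffunE // scaler0 addr0.
Qed.

HB.instance Definition _ i := GRing.isLinear.Build R (koszul_comod i.+1)
  (koszul_comod i) _ (@koszul_codiff i) (@koszul_codiff_is_linear i).

Lemma koszul_comod0 i (f : koszul_comod i) : (p < i)%N -> f = 0.
Proof.
move=> pi; apply/ffunP => U; have := valP U.
by move=> /eqP pE; move: pi; rewrite -pE ltnNge leq_addl.
Qed.

Lemma koszul_codiff_exact i (f : koszul_comod i.+1) :
  (forall j, (j < p)%N -> koszul_vanish y R^o j) ->
  koszul_codiff f = 0 <-> exists g, koszul_codiff (i := i.+1) g = f.
Proof.
move=> V; split=> [df|[g <-]]; last first.
  apply/ffunP => U; rewrite !ffunE.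
  rewrite -[RHS](koszul_deltaK y (koszul_ext g) (val U)).
  apply: koszul_delta_congr => T cT; apply: koszul_extE.
  by rewrite addnS -addSn cT (eqP (valP U)).
have [ip|pi] := ltnP i p; last first.
  by exists 0; rewrite linear0 [f]koszul_comod0.
(* [koszul_comod i.+1] holds the cochains of degree [p - i.+1], a true difference as [i < p]. *)
have [||g gP] := V (p - i.+1)%N _ (koszul_ext f).
- by rewrite ltn_subrL /=; case: (p) ip.
- move=> S cS; have cS' : (#|S| + i == p)%N by rewrite cS addSnnS subnK.
  have := congr1 (fun c : koszul_comod i => c (Sub S cS')) df.
  by rewrite !ffunE.
exists [ffun U => g (val U)]; apply/ffunP => U.
rewrite ffunE -koszul_ext_val gP.
  apply: koszul_delta_congr => T cT; apply: koszul_extE.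
  by rewrite addnS -addSn cT (eqP (valP U)).
by rewrite -[LHS](addnK i.+1) (eqP (valP U)).
Qed.

Definition koszul_coresolution
    (V : forall j, (j < p)%N -> koszul_vanish y R^o j) :
  left_resolution (coker (@koszul_codiff 0)).
Proof.
refine (@LeftResolution R (coker (@koszul_codiff 0)) koszul_comod
  (fun i => @koszul_codiff i) (@to_coker _ _ _ (@koszul_codiff 0)) _ _ _).
- exact: to_coker_surj.
- exact: to_coker0P.
- by move=> i f; exact: koszul_codiff_exact.
Defined.

Lemma le_fPD_of_proper : ~ ideal_gen y 1 ->
  (forall j, (j < p)%N -> koszul_vanish y R^o j) -> (efin p <= fPD R)%O.
Proof.
move=> y1 V; pose X := koszul_coresolution V.
have Xp : res_length_le X p by move=> i pi f; exact: koszul_comod0.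
have Xfree i : projective (res_obj X i) /\ fin_gen (res_obj X i).
  by split; [exact: free_projective|exact: free_fin_gen].
apply/le_esup; right; exists (proj_dim (coker (@koszul_codiff 0))).
  by exists (coker (@koszul_codiff 0)); split=> //; exists p, X.
apply/le_proj_dim => n Y Yn Yproj; rewrite leqNgt; apply/negP => np.
have [p' Ep] : exists p', p = p'.+1 by case: (p) np => // p' _; exists p'.
have Xp' : res_length_le X p'.+1 by rewrite -Ep.
have Yp' : res_length_le Y p'.
  by move=> i p'i; apply: Yn; apply: leq_ltn_trans p'i; rewrite -ltnS -Ep.
have [h hP] := resolution_top_split (fun i => proj1 (Xfree i)) Yproj Xp' Yp'.
have c0 : (#|finset.set0 : {set 'I_r}| + p'.+1 == p)%N by rewrite cards0 Ep.
(* [z] is the unit of the rank one module of degree 0 cochains. The coordinates of its image lie in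
   the ideal of [y], hence so does 1, the value of [h] there. *)
pose z : koszul_comod p'.+1 := [ffun=> 1].
have := congr1 (fun c : koszul_comod p'.+1 => c (Sub finset.set0 c0)) (hP z).
rewrite /= ffunE (free_eltE (koszul_codiff z)) linear_sum sum_ffunE => zE.
apply: y1; rewrite -zE; apply: ideal_gen_sum => U _.
rewrite linearZ ffunE [_ *: _]mulrC; apply: ideal_genM; rewrite ffunE.
exact: ideal_gen_delta.
Qed.

End KoszulResolution.

(** * Koszul grade at maximal ideals *)

(** By [koszul_coboundary_of_mul], used twice, a cocycle is a coboundary once its multiples by all
    [x i * x j] are; these products lie in the ideal of [y], which annihilates cohomology. *)
Lemma koszul_vanish_radical (R : comPzRingType) k l (x : 'I_k -> R)
    (y : 'I_l -> R) (N : lmodType R) p :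
  (forall i j, ideal_gen y (x i * x j)) ->
  (forall j, (j < p)%N -> koszul_vanish x N j) ->
  forall j, (j < p)%N -> koszul_vanish y N j.
Proof.
move=> xy Vx j; elim/ltn_ind: j => q IHq qp f df.
have Vy j : (j < q)%N -> koszul_vanish y N j.
  by move=> jq; apply: IHq => //; exact: ltn_trans qp.
have {}Vx j : (j <= q)%N -> koszul_vanish x N j.
  by move=> jq; apply: Vx; exact: leq_ltn_trans qp.
apply: (koszul_coboundary_of_mul Vy Vx) => i.
apply: (koszul_coboundary_of_mul Vy Vx) => j.
have [g gP] := koszul_annih_ideal (xy j i) df; exists g => T cT.
by rewrite -gP // scalerA.
Qed.

Lemma koszul_vanish_sub (R : comPzRingType) k l (x : 'I_k -> R)
    (y : 'I_l -> R) (N : lmodType R) p :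
  (forall i, ideal_gen y (x i)) ->
  (forall j, (j < p)%N -> koszul_vanish x N j) ->
  forall j, (j < p)%N -> koszul_vanish y N j.
Proof.
by move=> xy; apply: koszul_vanish_radical => i j; exact: ideal_genM.
Qed.

Section MaximalIdeals.
Variable R : comPzRingType.

Lemma ideal_gen_subset n (x : 'I_n -> R) (J : set R) :
  is_ideal J -> (forall i, J (x i)) -> ideal_gen x `<=` J.
Proof.
move=> [J0 JD JM] Jx _ [c ->]; apply: big_ind => // i _.
exact: JM.
Qed.

Lemma ideal_proper (J : set R) : is_ideal J -> J <> setT <-> ~ J 1.
Proof.
move=> [_ _ JM]; split=> [JT J1|J1 JT]; last by apply: J1; rewrite JT.
by apply: JT; apply/seteqP; split=> // a _; rewrite -[a]mulr1; exact: JM.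
Qed.

Lemma maximal_ideal_ex (I : set R) : is_ideal I -> ~ I 1 ->
  exists2 m, maximal_ideal m & I `<=` m.
Proof.
(* Taking the union with [I] makes the union of the empty chain admissible in Zorn's lemma. *)
move=> idI I1; pose P J := is_ideal (I `|` J) /\ ~ (I `|` J) 1.
have [F FP Ftot|A [[idA A1] maxA]] := @Zorn_bigcup R P.
  have FI X : F X -> is_ideal (I `|` X) by move=> /FP[].
  split; last first.
    by move=> [//|[X FX X1]]; have [_] := FP X FX; apply; right.
  have [I0 ID IM] := idI; split; first by left.
    move=> a b [Ia|[X FX Xa]] [Ib|[Y FY Yb]].
    - by left; apply: ID.
    - have [_ YD _] := FI Y FY.
      have [|Z] := YD a b (or_introl Ia) (or_intror Yb); first by left.
      by right; exists Y.
    - have [_ XD _] := FI X FX.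
      have [|Z] := XD a b (or_intror Xa) (or_introl Ib); first by left.
      by right; exists X.
    - have [Z [FZ Za Zb]] : exists Z, [/\ F Z, Z a & Z b].
        by have [/(_ a Xa)|/(_ b Yb)] := Ftot X Y FX FY; [exists Y|exists X].
      have [_ ZD _] := FI Z FZ.
      have [|W] := ZD a b (or_intror Za) (or_intror Zb); first by left.
      by right; exists Z.
  move=> r a [Ia|[X FX Xa]]; first by left; apply: IM.
  have [_ _ XM] := FI X FX.
  by have [|Z] := XM r a (or_intror Xa); [left|right; exists X].
exists (I `|` A); last by left.
split=> //; first exact/ideal_proper.
move=> J idJ IAJ; have [J1|J1] := pselect (J 1).
  by right; apply: contrapT => /(ideal_proper idJ).
left; have IJ : I `|` J = J.
  by apply/seteqP; split=> [a [Ia|//]|a]; [apply: IAJ; left|right].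
have PJ : P J by rewrite /P IJ.
apply/seteqP; split=> // a Ja; right; apply: contrapT => nAa.
apply: (maxA J) PJ; split=> [b Ab|/(_ a Ja)//].
by apply: IAJ; right.
Qed.

Lemma le_Kgrade p (J : set R) (N : lmodType R) :
  (efin p.+1 <= Kgrade J N)%O <-> exists n (x : 'I_n -> R),
    ideal_gen x `<=` J /\ forall j, (j < p.+1)%N -> koszul_vanish x N j.
Proof.
rewrite le_esup; split.
  by case=> [//|[_ [n [x [xJ ->]]] /le_koszul_grade_seq V]]; exists n, x.
move=> [n [x [xJ V]]]; right; exists (koszul_grade_seq x N).
  by exists n, x.
exact/le_koszul_grade_seq.
Qed.

Lemma le_sup_min_Kgrade p (M N : lmodType R) :
  (efin p.+1 <= esup [set Order.min (Kgrade m M) (Kgrade m N)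
                     | m in maximal_ideal (R := R)])%O <->
  exists n (x : 'I_n -> R), [/\ ~ ideal_gen x 1,
    forall j, (j < p.+1)%N -> koszul_vanish x M j &
    forall j, (j < p.+1)%N -> koszul_vanish x N j].
Proof.
rewrite le_esup; split=> [[//|[_ [m mmax <-]]]|[n [x [x1 VM VN]]]].
  rewrite le_min => /andP[/le_Kgrade[k [x [xm Vx]]] /le_Kgrade[l [y [ym Vy]]]].
  have [idm mT _] := mmax; move/(ideal_proper idm): mT => m1.
  (* The two grades may be witnessed by different sequences; their concatenation stays in [m] and
     inherits both vanishing properties. *)
  pose z (i : 'I_(k + l)) :=
    match fintype.split i with inl a => x a | inr b => y b end.
  have zl a : z (lshift l a) = x a by rewrite /z (unsplitK (inl a)).
  have zr b : z (rshift k b) = y b by rewrite /z (unsplitK (inr b)).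
  exists (k + l)%N, z; split.
  - apply: contra_not m1; apply: ideal_gen_subset => // i.
    rewrite /z; case: fintype.split => a; [apply: xm|apply: ym];
      exact: ideal_gen_mem.
  - by apply: koszul_vanish_sub Vx => a; rewrite -zl; exact: ideal_gen_mem.
  - by apply: koszul_vanish_sub Vy => b; rewrite -zr; exact: ideal_gen_mem.
have [m mmax xm] := maximal_ideal_ex (ideal_gen_is_ideal x) x1.
right; exists (Order.min (Kgrade m M) (Kgrade m N)); first by exists m.
by rewrite le_min; apply/andP; split; apply/le_Kgrade; exists n, x.
Qed.

Lemma le_fPD p : (efin p.+1 <= fPD R)%O <->
  exists n (x : 'I_n -> R), ~ ideal_gen x 1 /\
    forall j, (j < p.+1)%N -> koszul_vanish x R^o j.
Proof.
split=> [/proper_of_le_fPD//|[n [x [x1 V]]]].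
exact: le_fPD_of_proper V.
Qed.

End MaximalIdeals.

(** Positive finite bounds suffice, 0 being below everything; this avoids the case [p = 0] of
    [le_esup]. *)
Lemma le_enatP (a b : enat) :
  (forall p, (efin p.+1 <= a)%O -> (efin p.+1 <= b)%O) -> (a <= b)%O.
Proof.
case: b => [b|] ab; last by case: a {ab}.
rewrite leNgt; apply/negP => ba; suff : (efin b.+1 <= a)%O.
  by move/ab; rewrite /Order.le /= ltnn.
by case: a ba {ab} => [a|] //; rewrite ltNge /Order.le /= -ltnNge.
Qed.

(** * The trivial extension *)

Section TrivialExtension.
Variables (R : comPzRingType) (M : lmodType R).
Local Notation E := (trivext R M).

Definition trivext_base (a : R) : E := (a, 0).

Lemma trivext_mulE (a b : E) : a * b = (a.1 * b.1, a.1 *: b.2 + b.1 *: a.2).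
Proof. by []. Qed.

Lemma trivext_addE (a b : E) : a + b = (a.1 + b.1, a.2 + b.2).
Proof. by []. Qed.

Lemma trivext_fst_sum (I : finType) (P : pred I) (F : I -> E) :
  (\sum_(i | P i) F i).1 = \sum_(i | P i) (F i).1.
Proof. by apply: (big_morph (fun a : E => a.1)). Qed.

Lemma trivext_snd_sum (I : finType) (P : pred I) (F : I -> E) :
  (\sum_(i | P i) F i).2 = \sum_(i | P i) (F i).2.
Proof. by apply: (big_morph (fun a : E => a.2)). Qed.

Lemma trivext_base_mul a (b : E) : trivext_base a * b = (a * b.1, a *: b.2).
Proof. by rewrite trivext_mulE /= scaler0 addr0. Qed.

Lemma trivext_baseM a b :
  trivext_base (a * b) = trivext_base a * trivext_base b.
Proof. by rewrite trivext_base_mul /= scaler0. Qed.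

Lemma koszul_sign_trivext n (S : {set 'I_n}) i :
  koszul_sign E S i = trivext_base (koszul_sign R S i).
Proof.
rewrite /koszul_sign; elim: #|_| => // k IHk.
rewrite !exprS trivext_baseM -IHk; congr (_ * _).
by congr (_, _); rewrite oppr0.
Qed.

Lemma koszul_delta_trivext n (x : 'I_n -> R) (f : {set 'I_n} -> E^o) S :
  koszul_delta (fun i => trivext_base (x i)) f S =
  (koszul_delta x (fun T => (f T).1 : R^o) S,
   koszul_delta x (fun T => (f T).2) S).
Proof.
rewrite [LHS]surjective_pairing trivext_fst_sum trivext_snd_sum.
by congr (_, _); apply: eq_bigr => i _;
   rewrite koszul_sign_trivext -trivext_baseM [_ *: _]trivext_base_mul.
Qed.

(** Elements of the base ring act on the two coordinates separately, so the cochain complex is a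
    direct product. *)
Lemma koszul_vanish_trivext n (x : 'I_n -> R) q :
  koszul_vanish (fun i => trivext_base (x i)) E^o q <->
  koszul_vanish x R^o q /\ koszul_vanish x M q.
Proof.
split=> [V|[VR VM] f df].
  split=> f df.
    have [S cS|g gP] := V (fun T => (f T, 0)).
      rewrite koszul_delta_trivext /= df //; congr (_, _).
      by apply: big1 => i _; rewrite scaler0.
    exists (fun T => (g T).1) => S /gP.
    by rewrite koszul_delta_trivext => -[].
  have [S cS|g gP] := V (fun T => (0, f T)).
    rewrite koszul_delta_trivext /= df //; congr (_, _).
    by apply: big1 => i _; rewrite scaler0.
  exists (fun T => (g T).2) => S /gP.
  by rewrite koszul_delta_trivext => -[].
have [S cS|g gP] := VR (fun T => (f T).1).
  by have := df S cS; rewrite koszul_delta_trivext => -[].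
have [S cS|h hP] := VM (fun T => (f T).2).
  by have := df S cS; rewrite koszul_delta_trivext => -[].
exists (fun T => (g T, h T)) => S cS.
by rewrite koszul_delta_trivext -gP // -hP // -surjective_pairing.
Qed.

Lemma ideal_gen_trivext n (z : 'I_n -> E) :
  ideal_gen z 1 <-> ideal_gen (fun i => (z i).1) 1.
Proof.
split=> [[c c1]|[c c1]].
  by exists (fun i => (c i).1); move/(congr1 fst): c1; rewrite trivext_fst_sum.
pose w : E := \sum_i trivext_base (c i) * z i.
have w1 : w.1 = 1.
  rewrite trivext_fst_sum c1; apply: eq_bigr => i _.
  by rewrite trivext_base_mul.
(* Elements with first coordinate 0 have square zero, so [w] is a unit with this inverse. *)
have -> : 1 = ((1, - w.2) : E) * w.
  by rewrite trivext_mulE /= w1 mulr1 !scale1r addrN.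
by apply: ideal_genM; exists (fun i => trivext_base (c i)).
Qed.

(* The products [z i * z j] lie in the ideal generated by the first
   coordinates of the [z i], although the [z i] themselves need not. *)
Lemma koszul_vanish_trivext_base n (z : 'I_n -> E) p :
  (forall j, (j < p)%N -> koszul_vanish z E^o j) ->
  forall j, (j < p)%N ->
    koszul_vanish (fun i => trivext_base (z i).1) E^o j.
Proof.
apply: koszul_vanish_radical => i j.
have -> : z i * z j = z j * trivext_base (z i).1 +
    ((0, (z i).2) : E) * trivext_base (z j).1.
  rewrite !(mulrC _ (trivext_base _)) !trivext_base_mul.
  by rewrite trivext_mulE trivext_addE /= mulr0 addr0.
have [_ D _] := ideal_gen_is_ideal (fun i => trivext_base (z i).1).
by apply: D; apply: ideal_genM;
  [apply: (ideal_gen_mem _ i)|apply: (ideal_gen_mem _ j)].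
Qed.

End TrivialExtension.

Theorem theorem6p2 (R : comPzRingType) (M : lmodType R) :
  let s := esup [set Order.min (Kgrade m R^o) (Kgrade m M)
                | m in maximal_ideal (R := R)] in
  fPD (trivext R M) = s /\ (s <= fPD R)%O.
Proof.
move=> s; split; last first.
  apply: le_enatP => p /le_sup_min_Kgrade[n [x [x1 VR _]]].
  by apply/le_fPD; exists n, x.
apply/le_anti/andP; split; apply: le_enatP => p.
  move=> /le_fPD[n [z [z1 V]]]; apply/le_sup_min_Kgrade.
  exists n, (fun i => (z i).1).
  have {}V j : (j < p.+1)%N -> _ := fun jp =>
    proj1 (koszul_vanish_trivext _ _ _) (koszul_vanish_trivext_base V jp).
  split=> [|j /V[]//|j /V[]//].
  by move/ideal_gen_trivext: z1.
move=> /le_sup_min_Kgrade[n [x [x1 VR VM]]]; apply/le_fPD.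
exists n, (fun i => trivext_base M (x i)); split; last first.
  by move=> j jp; apply/koszul_vanish_trivext; split; [apply: VR|apply: VM].
by move/ideal_gen_trivext.
Qed.
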